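(* For every $\delta_0>0$ there exist constants $\bar\varepsilon=\bar\varepsilon(\delta_0)>0$ and $C=C(\delta_0)>0$, depending only on $\delta_0$, such that for all probability distributions $p$ and $q$ over a finite set $\mathcal X$ and all $\varepsilon$ with $0\le\varepsilon\le d_{\mathrm{TV}}(p,q)/4$ and $\varepsilon<\bar\varepsilon$, $$n^*_{\mathrm{Sub}}(\varepsilon)\le C\,n^*_{\mathrm{Hub}}(\varepsilon)\qquad\text{and}\qquad n^*_{\mathrm{Hub}}(\varepsilon)\le C\,n^*_{\mathrm{Sub}}((1+\delta_0)\varepsilon).$$
   Context: $\Delta(\mathcal X)$ is the set of probability distributions on $\mathcal X$; $d_{\mathrm{TV}}(p,q)=\frac12\sum_x|p(x)-q(x)|$. For $0\le\varepsilon<1$, $\mathcal P_{\mathrm{Hub}}(p,\varepsilon)=\{(1-\varepsilon)p+\varepsilon h: h\in\Delta(\mathcal X)\}$ and $\mathcal P_{\mathrm{Sub}}(p,\varepsilon)=\{p'\in\Delta(\mathcal X): p'(x)\le(1+\varepsilon)p(x)\ \forall x\in\mathcal X\}$. For $A\in\{\mathrm{Hub},\mathrm{Sub}\}$, the sample complexity $n^*_A(\varepsilon)$ (for the given $p,q$) is the smallest $n$ for which there is a (possibly randomised) test $\phi:\mathcal X^n\to\{0,1\}$ with $$\sup_{P\in\mathcal P_A(p,\varepsilon)}\mathbb P_{X^n\sim P^{\otimes n}}(\phi(X^n)=1)+\sup_{Q\in\mathcal P_A(q,\varepsilon)}\mathbb P_{X^n\sim Q^{\otimes n}}(\phi(X^n)=0)\le\tfrac1{10}$$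 ($n^*_A(\varepsilon)=\infty$ if there is none). *)

(* Defs.v *)
From HB Require Import structures.
From mathcomp Require Import all_boot all_order all_algebra.
From mathcomp Require Import boolp classical_sets reals constructive_ereal ereal.

Set Implicit Arguments.
Unset Strict Implicit.
Unset Printing Implicit Defensive.
Import Order.TTheory GRing.Theory Num.Theory.

Local Open Scope classical_set_scope.
Local Open Scope ring_scope.

(* Probability distributions on X, given by their mass functions. *)
Definition simplex (R : realType) (X : finType) : set (X -> R) :=
  [set p | (forall x, 0 <= p x) /\ \sum_x p x = 1].

Definition tv_dist (R : realType) (X : finType) (p q : X -> R) : R :=
  2^-1 * \sum_x `|p x - q x|.

Definition huber (R : realType) (X : finType) (p : X -> R) (eps : R) :
    set (X -> R) :=
  [set (fun x => (1 - eps) * p x + eps * h x) | h in @simplex R X].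

Definition subtractive (R : realType) (X : finType) (p : X -> R) (eps : R) :
    set (X -> R) :=
  [set p' | simplex p' /\ forall x, p' x <= (1 + eps) * p x].

(* Mass function of the n-fold product of P. *)
Definition iid (R : realType) (X : finType) (n : nat) (P : X -> R)
    (xs : n.-tuple X) : R :=
  \prod_(i < n) P (tnth xs i).

(* A randomised test is given by its conditional probability phi xs of
   answering 1 on the sample xs; deterministic tests are the {0,1}-valued phi. *)
Definition is_test (R : realType) (X : finType) (n : nat)
    (phi : n.-tuple X -> R) : Prop :=
  forall xs, 0 <= phi xs <= 1.

Definition prob_one (R : realType) (X : finType) (n : nat)
    (phi : n.-tuple X -> R) (P : X -> R) : R :=
  \sum_(xs : n.-tuple X) iid P xs * phi xs.

Definition prob_zero (R : realType) (X : finType) (n : nat)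
    (phi : n.-tuple X -> R) (P : X -> R) : R :=
  \sum_(xs : n.-tuple X) iid P xs * (1 - phi xs).

(* The real-valued sup is only meaningful on nonempty bounded sets: the sets of
   probabilities below are bounded, and nonempty as soon as U and V are. *)
Definition testable (R : realType) (X : finType) (U V : set (X -> R))
    (n : nat) : Prop :=
  exists2 phi : n.-tuple X -> R, is_test phi &
    sup [set prob_one phi P | P in U] + sup [set prob_zero phi Q | Q in V]
      <= 10^-1.

Definition sample_complexity (R : realType) (X : finType)
    (U V : set (X -> R)) : \bar R :=
  match pselect (exists n, `[< testable U V n >]) with
  | left ex_n => ((ex_minn ex_n)%:R)%:E
  | right _ => +oo%E
  end.

Definition n_hub (R : realType) (X : finType) (p q : X -> R) (eps : R) :
    \bar R :=
  sample_complexity (huber p eps) (huber q eps).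

Definition n_sub (R : realType) (X : finType) (p q : X -> R) (eps : R) :
    \bar R :=
  sample_complexity (subtractive p eps) (subtractive q eps).

(* Main.v *)
(* Both sample complexities are, up to constants, the inverse of the least squared
   Hellinger distance between the two uncertainty sets. A test with [n] samples
   forces that distance to be at least [1 / n]; conversely, for convex sets, a pair
   (P0, Q0) of maximal affinity (up to smoothing) yields the statistic
   [prod_i sqrt (Q0 / P0) (x_i)], whose expectation decays geometrically under
   every P by first-order optimality.

   It remains to compare the distances. A subtractive pair is turned into a Huber
   pair by giving to each hypothesis the mass removed from the other one. A Huber
   pair is turned into a subtractive pair by removing from the larger of p and q,
   pointwise, slightly more than what the Huber adversary adds to the smaller one;
   [eps <= tv_dist p q / 4] leaves room to remove the same total from p and from q,
   so that normalising rescales both by the same factor. *)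
Require Import Defs.
From mathcomp Require Import all_boot all_order all_algebra.
From mathcomp Require Import boolp classical_sets reals constructive_ereal ereal.
From mathcomp Require Import ring lra.

Import Order.TTheory GRing.Theory Num.Theory.
Local Open Scope classical_set_scope.
Local Open Scope ring_scope.

(** * Affinity, Hellinger distance and the lower bound on the number of samples *)

Section HellingerTesting.
Context {R : realType} {X : finType}.
Implicit Types (P Q p q g : X -> R) (U V : set (X -> R)).

Definition affinity P Q : R := \sum_x Num.sqrt (P x) * Num.sqrt (Q x).
(** The squared Hellinger distance, without the usual factor 1/2. *)
Definition hellinger P Q : R := \sum_x (Num.sqrt (P x) - Num.sqrt (Q x)) ^+ 2.

Lemma simplex_le1 P x : simplex P -> P x <= 1.
Proof.
by move=> [P0 <-]; rewrite (bigD1 x) //= lerDl sumr_ge0.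
Qed.

Lemma hellingerE P Q : simplex P -> simplex Q ->
  hellinger P Q = 2 - 2 * affinity P Q.
Proof.
move=> [P0 P1] [Q0 Q1].
have -> : hellinger P Q = \sum_x P x + \sum_x Q x - 2 * affinity P Q.
  rewrite /hellinger /affinity mulr_sumr -big_split -sumrB /=.
  apply: eq_bigr => x _.
  by rewrite -{2}[P x]sqr_sqrtr // -{2}[Q x]sqr_sqrtr //; ring.
by rewrite P1 Q1.
Qed.

Lemma affinity_ge0 P Q : 0 <= affinity P Q.
Proof. by apply: sumr_ge0 => x _; rewrite mulr_ge0 ?sqrtr_ge0. Qed.

Lemma sum_tuple_prod n g :
  \sum_(xs : n.-tuple X) \prod_(i < n) g (tnth xs i) = (\sum_x g x) ^+ n.
Proof.
rewrite -[n in RHS]card_ord -prodr_const bigA_distr_bigA /=.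
rewrite (reindex (fun t : n.-tuple X => [ffun i => tnth t i])) /=.
  by apply: eq_bigr => t _; apply: eq_bigr => i _; rewrite ffunE.
exists (fun f : {ffun 'I_n -> X} => [tuple f i | i < n]) => [t _|f _].
  by apply: eq_from_tnth => i; rewrite tnth_mktuple ffunE.
by apply/ffunP => i; rewrite ffunE tnth_mktuple.
Qed.

Lemma iid_ge0 n P (xs : n.-tuple X) : simplex P -> 0 <= iid P xs.
Proof. by move=> [P0 _]; apply: prodr_ge0. Qed.

Lemma sum_iid n P : simplex P -> \sum_(xs : n.-tuple X) iid P xs = 1.
Proof. by move=> [_ P1]; rewrite sum_tuple_prod P1 expr1n. Qed.

Lemma prob_one_le1 n (phi : n.-tuple X -> R) P :
  is_test phi -> simplex P -> prob_one phi P <= 1.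
Proof.
move=> phi01 sP; rewrite -(sum_iid n P sP); apply: ler_sum => xs _.
by case/andP: (phi01 xs) => _ h; rewrite ler_piMr // iid_ge0.
Qed.

Lemma prob_zero_le1 n (phi : n.-tuple X -> R) P :
  is_test phi -> simplex P -> prob_zero phi P <= 1.
Proof.
move=> phi01 sP; rewrite -(sum_iid n P sP); apply: ler_sum => xs _.
by case/andP: (phi01 xs) => h _; rewrite ler_piMr ?iid_ge0 // lerBlDr lerDl.
Qed.

(** Tensorisation: square roots commute with products of nonnegative masses. *)
Lemma affinity_iid n P Q :
  simplex P -> simplex Q ->
  affinity P Q ^+ n =
  \sum_(xs : n.-tuple X) Num.sqrt (iid P xs) * Num.sqrt (iid Q xs).
Proof.
move=> sP sQ; rewrite -sum_tuple_prod; apply: eq_bigr => xs _.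
rewrite big_split /=.
have sqrt_prod (A : X -> R) : simplex A ->
    Num.sqrt (iid A xs) = \prod_(i < n) Num.sqrt (A (tnth xs i)).
  move=> [A0 _]; rewrite /iid.
  have : 0 <= \prod_(i < n) A (tnth xs i) /\
    Num.sqrt (\prod_(i < n) A (tnth xs i)) =
      \prod_(i < n) Num.sqrt (A (tnth xs i)).
    apply: (big_ind2 (fun a b => 0 <= a /\ Num.sqrt a = b)).
    - by rewrite sqrtr1.
    - by move=> a b c d [a0 <-] [c0 <-]; rewrite mulr_ge0 // sqrtrM.
    - by [].
  by case.
by rewrite !sqrt_prod.
Qed.

(** Le Cam's two-point bound; a total error of 1/10 yields [2 * (1 / 10) + 2 / 8 = 9 / 20]. *)
Lemma testable_affinity U V n P Q :
  U `<=` @simplex R X -> V `<=` @simplex R X -> testable U V n ->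
  U P -> V Q -> affinity P Q ^+ n <= 9 / 20.
Proof.
move=> Us Vs [phi phi01 err] UP VQ.
have sP := Us _ UP; have sQ := Vs _ VQ.
have e1 : prob_one phi P <= sup [set prob_one phi P | P in U].
  apply: ub_le_sup; last by exists P.
  by exists 1 => _ [P' UP' <-]; exact: prob_one_le1 (Us _ UP').
have e2 : prob_zero phi Q <= sup [set prob_zero phi Q | Q in V].
  apply: ub_le_sup; last by exists Q.
  by exists 1 => _ [P' UP' <-]; exact: prob_zero_le1 (Vs _ UP').
rewrite affinity_iid //.
(* AM-GM [sqrt a * sqrt b <= 2 a + b / 8], the larger weight going to the error. *)
have : \sum_(xs : n.-tuple X) Num.sqrt (iid P xs) * Num.sqrt (iid Q xs) <=
    2 * (prob_one phi P + prob_zero phi Q) +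
    8^-1 * (\sum_(xs : n.-tuple X) iid P xs + \sum_(xs : n.-tuple X) iid Q xs).
  rewrite /prob_one /prob_zero -!big_split /= !mulr_sumr -big_split /=.
  apply: ler_sum => xs _; case/andP: (phi01 xs).
  have := iid_ge0 n P xs sP; have := iid_ge0 n Q xs sQ.
  move: (iid P xs) (iid Q xs) (phi xs) => a b f b0 a0 f0 f1.
  have := sqr_sqrtr a0; have := sqr_sqrtr b0.
  move: (Num.sqrt a) (Num.sqrt b) => u v <- <-.
  have := mulr_ge0 f0 (sqr_ge0 (4 * u - v)).
  have := mulr_ge0 (_ : 0 <= 1 - f) (sqr_ge0 (u - 4 * v)).
  by rewrite subr_ge0 => /(_ f1); nra.
rewrite !sum_iid //; lra.
Qed.

(** For the affinity [a], Bernoulli's inequality gives [1 - n * (1 - a) <= a ^+ n <= 9 / 20], while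
    the squared distance is [2 * (1 - a)]. *)
Lemma testable_hellinger U V n P Q :
  U `<=` @simplex R X -> V `<=` @simplex R X -> testable U V n ->
  U P -> V Q -> 1 <= n%:R * hellinger P Q.
Proof.
move=> Us Vs T UP VQ.
have := testable_affinity U V n P Q Us Vs T UP VQ.
rewrite hellingerE; [|exact: Us|exact: Vs].
have a0 := affinity_ge0 P Q; move: (affinity P Q) a0 => a a0.
have : 1 + n%:R * (a - 1) <= a ^+ n.
  elim: n {T} => [|n IH]; first by rewrite mul0r expr0 addr0.
  rewrite exprS -natr1; have := sqr_ge0 (a - 1).
  have := ler_wpM2l a0 IH; have := ler0n R n.
  move: (n%:R : R) (a ^+ n) => N b; nra.
lra.
Qed.

(** * Tests for convex sets, built from nearly closest pairs *)

Definition mix_closed U := forall P P' t, U P -> U P' -> 0 <= t <= 1 ->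
  U (fun x => P x + t * (P' x - P x)).

Lemma sqrt_second_order (a s : R) : 0 < a -> 0 <= a + s ->
  Num.sqrt a + s / (2 * Num.sqrt a) - s ^+ 2 / (2 * Num.sqrt a ^+ 3)
    <= Num.sqrt (a + s).
Proof.
move=> a0 as0; have := sqr_sqrtr as0; have := sqr_sqrtr (ltW a0).
have := sqrtr_ge0 (a + s); have : 0 < Num.sqrt a by rewrite sqrtr_gt0.
move: (Num.sqrt a) (Num.sqrt (a + s)) => u v u0 v0 ua va.
have -> : s = v ^+ 2 - u ^+ 2 by rewrite va ua; ring.
rewrite -subr_ge0.
have -> : v - (u + (v ^+ 2 - u ^+ 2) / (2 * u)
    - (v ^+ 2 - u ^+ 2) ^+ 2 / (2 * u ^+ 3)) =
    v * (v - u) ^+ 2 * (v + 2 * u) / (2 * u ^+ 3).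
  by field; rewrite lt0r_neq0.
have u1 := ltW u0.
by rewrite divr_ge0 ?(sqr_ge0, exprn_ge0, mulr_ge0, addr_ge0).
Qed.

(* The shift by [s ^+ 2] keeps the square roots differentiable at zero masses. *)
Definition shifted_affinity (s : R) P Q : R :=
  \sum_x Num.sqrt (P x + s ^+ 2) * Num.sqrt (Q x + s ^+ 2).

Lemma shifted_affinityC s P Q : shifted_affinity s P Q = shifted_affinity s Q P.
Proof. by apply: eq_bigr => x _; rewrite mulrC. Qed.

Lemma sqrt_add_sqr (a s : R) : 0 <= a -> 0 <= s ->
  Num.sqrt (a + s ^+ 2) <= Num.sqrt a + s.
Proof.
move=> a0 s0; rewrite -[leRHS]ger0_norm ?addr_ge0 ?sqrtr_ge0 //.
rewrite -sqrtr_sqr ler_wsqrtr // sqrrD sqr_sqrtr // lerD2r lerDl.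
by rewrite mulrn_wge0 ?mulr_ge0 ?sqrtr_ge0.
Qed.

(** Each root is at most 1 and grows by at most [s], so each product grows by at most
    [2 * s + s ^+ 2 <= 3 * s]. *)
Lemma shifted_affinity_le s P Q : simplex P -> simplex Q -> 0 <= s <= 1 ->
  shifted_affinity s P Q <= affinity P Q + 3 * s * #|X|%:R.
Proof.
move=> sP sQ /andP[s0 s1]; rewrite -sumr_const mulr_sumr -big_split /=.
apply: ler_sum => x _.
have /sqrt_add_sqr /(_ s0) hP : 0 <= P x by case: sP.
have /sqrt_add_sqr /(_ s0) hQ : 0 <= Q x by case: sQ.
have : Num.sqrt (P x) <= 1 by rewrite -sqrtr1 ler_wsqrtr // simplex_le1.
have : Num.sqrt (Q x) <= 1 by rewrite -sqrtr1 ler_wsqrtr // simplex_le1.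
have := ler_pM (sqrtr_ge0 _) (sqrtr_ge0 _) hP hQ.
have := sqrtr_ge0 (P x); have := sqrtr_ge0 (Q x).
nra.
Qed.

(** Approximate first-order optimality: moving by [t] towards [P] gains at least [t / 2] times the
    slope minus a second-order loss, and near-maximality caps the gain at [eta]. Dividing by [t / 2]
    gives the two error terms. *)
Lemma near_max_direction s t eta P0 P Q : simplex P0 -> simplex P -> simplex Q ->
  0 < s <= 1 -> 0 < t <= 1 ->
  shifted_affinity s (fun x => P0 x + t * (P x - P0 x)) Q
    <= shifted_affinity s P0 Q + eta ->
  \sum_x P x * (Num.sqrt (Q x + s ^+ 2) / Num.sqrt (P0 x + s ^+ 2))
    <= shifted_affinity s P0 Q + 2 * eta / t + 2 * t * #|X|%:R / s ^+ 3.
Proof.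
move=> sP0 sP sQ /andP[s0 s1] /andP[t0 t1] near_max.
pose g x := Num.sqrt (Q x + s ^+ 2) / Num.sqrt (P0 x + s ^+ 2).
have P0_ge0 x : 0 <= P0 x by case: sP0.
have P_ge0 x : 0 <= P x by case: sP.
have Q_ge0 x : 0 <= Q x by case: sQ.
have a_gt0 x : 0 < P0 x + s ^+ 2 by rewrite ltr_wpDl // exprn_gt0.
have g_ge0 x : 0 <= g x by rewrite divr_ge0 ?sqrtr_ge0.
have slope : t / 2 * \sum_x (P x - P0 x) * g x <=
    eta + t ^+ 2 * #|X|%:R / s ^+ 3.
  have : shifted_affinity s P0 Q + t / 2 * (\sum_x (P x - P0 x) * g x)
      - t ^+ 2 / s ^+ 3 * #|X|%:R <=
      shifted_affinity s (fun x => P0 x + t * (P x - P0 x)) Q.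
    rewrite -sumr_const !mulr_sumr -big_split -sumrB /=.
    apply: ler_sum => x _.
    have as0 : 0 <= P0 x + s ^+ 2 + t * (P x - P0 x).
      have := P0_ge0 x; have := P_ge0 x; have := sqr_ge0 s; nra.
    have := sqrt_second_order _ _ (a_gt0 x) as0.
    rewrite (_ : P0 x + t * (P x - P0 x) + s ^+ 2 =
      P0 x + s ^+ 2 + t * (P x - P0 x)); last by ring.
    move=> /(ler_wpM2r (sqrtr_ge0 (Q x + s ^+ 2))); apply: le_trans.
    have u0 : s <= Num.sqrt (P0 x + s ^+ 2).
      by rewrite -[leLHS](ger0_norm (ltW s0)) -sqrtr_sqr ler_wsqrtr // lerDr.
    have b2 : Num.sqrt (Q x + s ^+ 2) <= 2.
      apply: le_trans (sqrt_add_sqr _ _ (Q_ge0 x) (ltW s0)) _.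
      have : Num.sqrt (Q x) <= 1 by rewrite -sqrtr1 ler_wsqrtr // simplex_le1.
      lra.
    have d1 : (P x - P0 x) ^+ 2 <= 1.
      have := simplex_le1 P x sP; have := simplex_le1 P0 x sP0.
      have := P_ge0 x; have := P0_ge0 x; nra.
    rewrite /g; have := sqrtr_ge0 (Q x + s ^+ 2).
    move: (Num.sqrt (P0 x + s ^+ 2)) (Num.sqrt (Q x + s ^+ 2)) u0 b2 => u b us b2 b0.
    have u0 : 0 < u by apply: lt_le_trans us.
    rewrite -subr_ge0.
    have -> : (u + t * (P x - P0 x) / (2 * u)
         - (t * (P x - P0 x)) ^+ 2 / (2 * u ^+ 3)) * b
       - (u * b + t / 2 * ((P x - P0 x) * (b / u)) - t ^+ 2 / s ^+ 3 * 1) =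
       t ^+ 2 * ((s ^+ 3)^-1 - (P x - P0 x) ^+ 2 * (b / 2) * (u ^+ 3)^-1).
      by field; rewrite !lt0r_neq0.
    rewrite mulr_ge0 ?sqr_ge0 // subr_ge0.
    apply: (@le_trans _ _ (1 * 1 * (u ^+ 3)^-1)).
      rewrite ler_wpM2r ?invr_ge0 ?exprn_ge0 ?(ltW u0) // ler_pM ?sqr_ge0 //; lra.
    by rewrite !mul1r lef_pV2 ?posrE ?exprn_gt0 // lerXn2r ?nnegrE ?(ltW u0) ?(ltW s0).
  move=> low; have := le_trans low near_max; lra.
have eqF : shifted_affinity s P0 Q = \sum_x (P0 x + s ^+ 2) * g x.
  apply: eq_bigr => x _; rewrite /g -{2}(sqr_sqrtr (ltW (a_gt0 x))).
  have : Num.sqrt (P0 x + s ^+ 2) != 0 by rewrite lt0r_neq0 // sqrtr_gt0.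
  by move=> u0; field.
have slope' : \sum_x (P x - P0 x) * g x <=
    2 * eta / t + 2 * t * #|X|%:R / s ^+ 3.
  rewrite -(ler_pM2l (_ : 0 < t / 2)); last by rewrite divr_gt0.
  apply: le_trans slope _; rewrite le_eqVlt; apply/orP; left; apply/eqP.
  by field; rewrite !lt0r_neq0.
apply: le_trans (_ : shifted_affinity s P0 Q + \sum_x (P x - P0 x) * g x <= _).
  rewrite eqF -big_split /=; apply: ler_sum => x _.
  have := mulr_ge0 (sqr_ge0 s) (g_ge0 x); rewrite -/(g x); lra.
by rewrite -addrA lerD2l.
Qed.

(* Birge's argument: [g = sqrt (Q0 / P0)] at a pair (P0, Q0) that nearly maximises
   the shifted affinity; working with near-maximisers avoids compactness. *)
Lemma uniform_ratio U V y :
  U `<=` @simplex R X -> V `<=` @simplex R X -> mix_closed U -> mix_closed V ->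
  U !=set0 -> V !=set0 -> 0 < y ->
  (forall P Q, U P -> V Q -> affinity P Q <= 1 - y) ->
  exists g, [/\ forall x, 0 < g x,
    forall P, U P -> \sum_x P x * g x <= 1 - y / 2 &
    forall Q, V Q -> \sum_x Q x / g x <= 1 - y / 2].
Proof.
move=> Us Vs cU cV [P1 UP1] [Q1 VQ1] y0 aff.
have y1 : y <= 1.
  have := aff _ _ UP1 VQ1; have := affinity_ge0 P1 Q1; lra.
(* Error budget: the shift [s] costs at most [y / 4], the second-order loss governed by [t] at most
   [y / 8], and [eta] exactly [y / 8]; half of [y] remains. *)
pose N : R := #|X|%:R + 1.
have N1 : 1 <= N by rewrite lerDr.
have N0 : 0 < N by lra.
have XN : #|X|%:R <= N by rewrite lerDl.
pose s := y / (12 * N).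
have s0 : 0 < s by rewrite divr_gt0 // mulr_gt0.
have s1 : s <= 1 by rewrite ler_pdivrMr ?mulr_gt0 //; lra.
pose t := s ^+ 3 * y / (16 * N).
have t0 : 0 < t by rewrite divr_gt0 // mulr_gt0 // exprn_gt0.
have t1 : t <= 1.
  rewrite ler_pdivrMr ?mulr_gt0 //.
  have s3 : s ^+ 3 <= 1 by rewrite exprn_ile1 // ltW.
  have := exprn_gt0 3 s0; nra.
pose eta := t * y / 16.
have eta0 : 0 < eta by rewrite divr_gt0 // mulr_gt0.
have sX : 3 * s * #|X|%:R <= y / 4.
  apply: (@le_trans _ _ (3 * s * N)); first by rewrite ler_wpM2l // mulr_ge0 // ltW.
  by rewrite le_eqVlt; apply/orP; left; apply/eqP; rewrite /s; field; rewrite lt0r_neq0.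
have Fle P Q : U P -> V Q -> shifted_affinity s P Q <= 1 - y * 3 / 4.
  move=> UP VQ; have := aff _ _ UP VQ.
  have := shifted_affinity_le s P Q (Us _ UP) (Vs _ VQ).
  by rewrite (ltW s0) s1 => /(_ isT); lra.
pose E : set R := [set r | exists P Q, [/\ U P, V Q & r = shifted_affinity s P Q]].
have supE : has_sup E.
  split; first by exists (shifted_affinity s P1 Q1), P1, Q1.
  by exists (1 - y * 3 / 4) => _ [P [Q [UP VQ ->]]]; exact: Fle.
have [_ [P0 [Q0 [UP0 VQ0 ->]]] near_sup] := sup_adherent eta0 supE.
have near_max P Q : U P -> V Q ->
    shifted_affinity s P Q <= shifted_affinity s P0 Q0 + eta.
  move=> UP VQ.
  have : shifted_affinity s P Q <= sup E.
    by apply: ub_le_sup; [case: supE | exists P, Q].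
  lra.
have t01 : 0 <= t <= 1 by rewrite ltW.
have small : shifted_affinity s P0 Q0 + 2 * eta / t + 2 * t * #|X|%:R / s ^+ 3
    <= 1 - y / 2.
  have -> : 2 * eta / t = y / 8 by rewrite /eta; field; rewrite lt0r_neq0.
  have : 2 * t * #|X|%:R / s ^+ 3 <= y / 8.
    apply: (@le_trans _ _ (2 * t * N / s ^+ 3)).
      apply: ler_wpM2r; first by rewrite invr_ge0 exprn_ge0 // ltW.
      by apply: ler_wpM2l => //; apply: mulr_ge0 => //; exact: ltW.
    rewrite le_eqVlt; apply/orP; left; apply/eqP.
    by rewrite /t; field; rewrite !lt0r_neq0.
  have := Fle _ _ UP0 VQ0; lra.
have s01 : 0 < s <= 1 by rewrite s0.
have tt : 0 < t <= 1 by rewrite t0.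
have pos (A : X -> R) x : simplex A -> 0 < Num.sqrt (A x + s ^+ 2).
  by move=> [A0 _]; rewrite sqrtr_gt0 ltr_wpDl // exprn_gt0.
exists (fun x => Num.sqrt (Q0 x + s ^+ 2) / Num.sqrt (P0 x + s ^+ 2)); split.
- by move=> x; rewrite divr_gt0 // pos //; [exact: Vs | exact: Us].
- move=> P UP; apply: le_trans small.
  apply: near_max_direction; [exact: Us|exact: Us|exact: Vs|by []|by []|].
  by apply: near_max => //; exact: cU.
(* Exchanging the two hypotheses replaces [g] by its inverse. *)
- move=> Q VQ; apply: le_trans small.
  under eq_bigr do rewrite invf_div.
  rewrite shifted_affinityC.
  apply: near_max_direction; [exact: Vs|exact: Vs|exact: Us|by []|by []|].
  rewrite shifted_affinityC (shifted_affinityC s Q0).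
  by apply: near_max => //; exact: cV.
Qed.

Lemma sum_iid_prod n P g :
  \sum_(xs : n.-tuple X) iid P xs * \prod_(i < n) g (tnth xs i) =
  (\sum_x P x * g x) ^+ n.
Proof.
by rewrite -sum_tuple_prod; apply: eq_bigr => xs _; rewrite big_split.
Qed.

(** The randomised test answers 1 with probability [T / (1 + T)], which is at most [T], and 0 with
    probability at most [1 / T]. Both expectations are [n]-th powers of numbers at most
    [1 - y / 2]. *)
Lemma affinity_testable U V y n :
  U `<=` @simplex R X -> V `<=` @simplex R X -> mix_closed U -> mix_closed V ->
  U !=set0 -> V !=set0 -> 0 < y ->
  (forall P Q, U P -> V Q -> affinity P Q <= 1 - y) ->
  38 <= n%:R * y -> testable U V n.
Proof.
move=> Us Vs cU cV U0 V0 y0 aff ny.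
have [g [g0 EPg EQg]] := uniform_ratio U V y Us Vs cU cV U0 V0 y0 aff.
pose T (xs : n.-tuple X) := \prod_(i < n) g (tnth xs i).
have T0 xs : 0 < T xs by apply: prodr_gt0.
have T1 xs : 0 < 1 + T xs by rewrite addr_gt0.
have decay z : 0 <= z <= 1 - y / 2 -> z ^+ n <= 20^-1.
  move=> /andP[z0 zy].
  (* The constant 38 makes the second factor at least [1 + 38 / 2 = 20]. *)
  suff : z ^+ n * (1 + n%:R * (y / 2)) <= 1.
    have := exprn_ge0 n z0; have : 20 <= 1 + n%:R * (y / 2) by lra.
    nra.
  elim: n {T T0 T1 ny} => [|n IH]; first by rewrite expr0 mul0r addr0 mul1r.
  apply: le_trans IH; rewrite exprSr -mulrA ler_wpM2l ?exprn_ge0 // -natr1.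
  have c0 : 0 <= 1 + (n%:R + 1) * (y / 2).
    by rewrite addr_ge0 // mulr_ge0 ?addr_ge0 // divr_ge0 // ltW.
  apply: le_trans (ler_wpM2r c0 zy) _.
  have := mulr_ge0 (ler0n R n) (sqr_ge0 y); have := sqr_ge0 y; lra.
have iidle (A : X -> R) (f h : n.-tuple X -> R) : simplex A ->
    (forall xs, f xs <= h xs) ->
    \sum_(xs : n.-tuple X) iid A xs * f xs <= \sum_(xs : n.-tuple X) iid A xs * h xs.
  by move=> sA fh; apply: ler_sum => xs _; rewrite ler_wpM2l // iid_ge0.
exists (fun xs => T xs / (1 + T xs)).
  by move=> xs; rewrite divr_ge0 ?(ltW (T0 _)) ?(ltW (T1 _)) //= ler_pdivrMr // mul1r lerDr.
suff [e1 e2] : sup [set prob_one (fun xs => T xs / (1 + T xs)) P | P in U] <= 20^-1 /\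
    sup [set prob_zero (fun xs => T xs / (1 + T xs)) Q | Q in V] <= 20^-1 by lra.
split; apply: ge_sup.
- by case: U0 => P UP; exists (prob_one (fun xs => T xs / (1 + T xs)) P), P.
- move=> _ [P UP <-]; have sP := Us _ UP.
  apply: le_trans (decay _ (_ : 0 <= \sum_x P x * g x <= _)); last first.
    by rewrite EPg // andbT sumr_ge0 // => x _; rewrite mulr_ge0 ?(ltW (g0 _)) //; case: sP.
  rewrite -sum_iid_prod; apply: iidle => // xs.
  by rewrite ler_pdivrMr // ler_peMr ?(ltW (T0 _)) // lerDl ltW.
- by case: V0 => Q VQ; exists (prob_zero (fun xs => T xs / (1 + T xs)) Q), Q.
- move=> _ [Q VQ <-]; have sQ := Vs _ VQ.
  apply: le_trans (decay _ (_ : 0 <= \sum_x Q x / g x <= _)); last first.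
    by rewrite EQg // andbT sumr_ge0 // => x _; rewrite divr_ge0 ?(ltW (g0 _)) //; case: sQ.
  rewrite -(sum_iid_prod n Q (fun x => (g x)^-1)); apply: iidle => // xs.
  rewrite prodfV -/(T xs).
  have -> : 1 - T xs / (1 + T xs) = (1 + T xs)^-1 by field; rewrite lt0r_neq0.
  by rewrite lef_pV2 ?posrE // lerDr.
Qed.

(** * From a comparison of distances to a comparison of sample complexities *)

Lemma testable_transfer U V U' V' (K n : nat) :
  U `<=` @simplex R X -> V `<=` @simplex R X ->
  U' `<=` @simplex R X -> V' `<=` @simplex R X ->
  mix_closed U' -> mix_closed V' -> U' !=set0 -> V' !=set0 ->
  (forall P' Q', U' P' -> V' Q' -> exists P Q,
     [/\ U P, V Q & hellinger P Q <= K%:R * hellinger P' Q']) ->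
  testable U V n -> testable U' V' (76 * K * n).
Proof.
move=> Us Vs U's V's cU' cV' U'0 V'0 dom T.
have lower P' Q' : U' P' -> V' Q' -> 1 <= (K * n)%:R * hellinger P' Q'.
  move=> UP' VQ'; have [P [Q [UP VQ PQ]]] := dom _ _ UP' VQ'.
  apply: le_trans (testable_hellinger U V n P Q Us Vs T UP VQ) _.
  by rewrite mulnC natrM -mulrA ler_wpM2l.
have Kn0 : 0 < (K * n)%:R :> R.
  case: (U'0) (V'0) => P' UP' [Q' VQ']; have := lower _ _ UP' VQ'.
  rewrite lt0r ler0n andbT; case: eqP => // ->; rewrite mul0r; lra.
(* One minus the affinity is half the squared distance, hence the factor 2 here and [76 = 2 * 38]
   samples per unit of [K * n]. *)
apply: (affinity_testable _ _ ((2 * (K * n)%:R)^-1)) => //.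
- rewrite invr_gt0; lra.
- move=> P' Q' UP' VQ'; have := lower _ _ UP' VQ'.
  rewrite hellingerE; [|exact: U's|exact: V's].
  rewrite -ler_pdivrMl // mulr1 invfM; lra.
- rewrite -mulnA natrM le_eqVlt; apply/orP; left; apply/eqP.
  by move: (K * n)%:R Kn0 => z z0; field; rewrite lt0r_neq0.
Qed.

(** Positivity of [C] matters when [U] and [V] admit no test: [C * +oo] must be [+oo], whereas
    [0 * +oo] is 0. *)
Lemma sample_complexity_le U V U' V' (C : nat) : (0 < C)%N ->
  (forall n, testable U V n -> testable U' V' (C * n)) ->
  (sample_complexity U' V' <= (C%:R)%:E * sample_complexity U V)%E.
Proof.
move=> C0 UV; rewrite /sample_complexity.
case: pselect => [ex'|nex']; case: pselect => [ex|nex].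
- rewrite -EFinM lee_fin -natrM ler_nat.
  case: ex_minnP => m /asboolP _; apply; case: ex_minnP => k /asboolP Tk _.
  by apply/asboolP; exact: UV.
- by rewrite gt0_muley ?leey // lte_fin ltr0n.
- case: nex'; case: ex => n /asboolP /UV Tn; exists (C * n)%N; exact/asboolP.
- by rewrite gt0_muley // lte_fin ltr0n.
Qed.
End HellingerTesting.

(** * The contamination sets, and the passage from subtractive to Huber pairs *)

Section Contamination.
Context {R : realType} {X : finType}.
Implicit Types (P Q p q g : X -> R) (U V : set (X -> R)).

Lemma simplex_mix : @mix_closed R X (@simplex R X).
Proof.
move=> P P' t [P0 P1] [P'0 P'1] /andP[t0 t1]; split=> [x|].
  have := P0 x; have := P'0 x; nra.
by rewrite big_split -mulr_sumr sumrB /= P1 P'1 subrr mulr0 addr0.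
Qed.

Lemma subtractive_simplex p eps : subtractive p eps `<=` @simplex R X.
Proof. by move=> P []. Qed.

Lemma subtractive_mix p eps : mix_closed (subtractive p eps).
Proof.
move=> P P' t [sP Pp] [sP' P'p] t01; split; first exact: simplex_mix.
by move=> x; have := Pp x; have := P'p x; case/andP: t01; nra.
Qed.

Lemma subtractive_self p eps : simplex p -> 0 <= eps -> subtractive p eps p.
Proof.
by move=> sp e0; split=> // x; rewrite ler_peMl ?lerDl //; case: sp.
Qed.

(** The noise is recovered as [(P - (1 - eps) * p) / eps]. At [eps = 0], domination with equal total
    masses forces [P = p]. *)
Lemma huberP p eps P : simplex p -> 0 <= eps <= 1 ->
  huber p eps P <-> simplex P /\ forall x, (1 - eps) * p x <= P x.
Proof.
move=> [p0 p1] /andP[e0 e1]; split=> [[h [h0 h1] <-]|[[P0 P1] pP]].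
  split; first split.
  - by move=> x; have := p0 x; have := h0 x; nra.
  - by rewrite big_split -!mulr_sumr /= p1 h1 !mulr1 subrK.
  - by move=> x; rewrite lerDl mulr_ge0.
move: e0; rewrite le_eqVlt => /orP[/eqP e0|e0].
  exists p; first by [].
  apply/funext => x; rewrite -e0 subr0 mul1r mul0r addr0; apply/eqP.
  rewrite eq_sym -subr_eq0; apply/eqP.
  apply: (psumr_eq0P (P := xpredT) (F := fun x => P x - p x)) => // [y _|].
    by have := pP y; rewrite -e0 subr0 mul1r subr_ge0.
  by rewrite sumrB P1 p1 subrr.
exists (fun x => (P x - (1 - eps) * p x) / eps); last first.
  by apply/funext => x; field; rewrite lt0r_neq0.
split=> [x|]; first by rewrite divr_ge0 ?subr_ge0 // ltW.
rewrite -mulr_suml sumrB -mulr_sumr P1 p1 mulr1.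
by rewrite opprB addrC subrK divff // lt0r_neq0.
Qed.

Lemma huber_simplex p eps : simplex p -> 0 <= eps <= 1 ->
  huber p eps `<=` @simplex R X.
Proof. by move=> sp e01 P /huberP[]. Qed.

Lemma huber_mix p eps : simplex p -> 0 <= eps <= 1 -> mix_closed (huber p eps).
Proof.
move=> sp e01 P P' t /huberP[//|//|sP pP] /huberP[//|//|sP' pP'] t01.
apply/huberP => //; split; first exact: simplex_mix.
by move=> x; have := pP x; have := pP' x; case/andP: t01; nra.
Qed.

Lemma huber_self p eps : simplex p -> 0 <= eps <= 1 -> huber p eps p.
Proof.
move=> sp e01; apply/huberP => //; split=> // x.
have [p0 _] := sp; have := p0 x; case/andP: e01; nra.
Qed.

(** Scaling by [k] scales the squared distance by [k], and adding a common measure only lowers it,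
    by Cauchy-Schwarz ([cross]). *)
Lemma hellinger_shift P Q P' Q' (k : R) (w : X -> R) : 0 <= k <= 1 ->
  (forall x, 0 <= P x) -> (forall x, 0 <= Q x) -> (forall x, 0 <= w x) ->
  (forall x, P' x = k * P x + w x) -> (forall x, Q' x = k * Q x + w x) ->
  hellinger P' Q' <= hellinger P Q.
Proof.
move=> /andP[k0 k1] P0 Q0 w0 P'E Q'E; apply: ler_sum => x _.
rewrite P'E Q'E; have := P0 x; have := Q0 x; have := w0 x.
move: (P x) (Q x) (w x) => a b c c0 b0 a0.
have ka0 := mulr_ge0 k0 a0; have kb0 := mulr_ge0 k0 b0.
have cross : k * (Num.sqrt a * Num.sqrt b) + c <=
    Num.sqrt (k * a + c) * Num.sqrt (k * b + c).
  rewrite -(sqrtrM _ (addr_ge0 ka0 c0)) -[leLHS]ger0_norm; last first.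
    by rewrite addr_ge0 ?mulr_ge0 ?sqrtr_ge0.
  rewrite -sqrtr_sqr ler_wsqrtr //.
  have := sqr_sqrtr a0; have := sqr_sqrtr b0.
  move: (Num.sqrt a) (Num.sqrt b) => u v <- <-.
  have := mulr_ge0 (mulr_ge0 k0 c0) (sqr_ge0 (u - v)); nra.
have := sqr_sqrtr (addr_ge0 ka0 c0); have := sqr_sqrtr (addr_ge0 kb0 c0).
have := sqr_sqrtr a0; have := sqr_sqrtr b0.
have := mulr_ge0 (_ : 0 <= 1 - k) (sqr_ge0 (Num.sqrt a - Num.sqrt b)).
rewrite subr_ge0 => /(_ k1).
move: (Num.sqrt a) (Num.sqrt b) cross => u v.
move: (Num.sqrt (k * a + c)) (Num.sqrt (k * b + c)) => u' v'.
nra.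
Qed.

(* With [a = (1 + eps) p - P'] and [b = (1 + eps) q - Q'] the masses removed from
   [p] and [q], adding [b] to [p] and [a] to [q] leaves the scaled pair
   [(k P', k Q')] shifted by a common measure. *)
Lemma subtractive_to_huber p q eps P' Q' :
  simplex p -> simplex q -> 0 <= eps <= 1 ->
  subtractive p eps P' -> subtractive q eps Q' ->
  exists P Q, [/\ huber p eps P, huber q eps Q & hellinger P Q <= hellinger P' Q'].
Proof.
move=> sp sq e01 [sP' P'p] [sQ' Q'q]; have /andP[e0 e1] := e01.
have [p0 p1] := sp; have [q0 q1] := sq.
have [P'0 P'1] := sP'; have [Q'0 Q'1] := sQ'.
(* This scale turns the cap [(1 + eps) * p] into the Huber floor [(1 - eps) * p]. *)
pose k := (1 - eps) / (1 + eps).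
have d0 : 0 < 1 + eps by lra.
have k0 : 0 <= k by rewrite divr_ge0 ?subr_ge0 // ltW.
have k1 : k <= 1 by rewrite ler_pdivrMr //; lra.
have kE : k * (1 + eps) = 1 - eps by rewrite /k divfK // lt0r_neq0.
have ek0 : 0 <= eps * (1 - k) by rewrite mulr_ge0 // subr_ge0.
(* The scaled removed mass is only [k * eps]; the missing [eps * (1 - k)] is filled with the same
   multiple of [p] in both, so it joins the common shift. *)
pose P x := (1 - eps) * p x + (k * ((1 + eps) * q x - Q' x) + eps * (1 - k) * p x).
pose Q x := (1 - eps) * q x + (k * ((1 + eps) * p x - P' x) + eps * (1 - k) * p x).
have P_ge x : (1 - eps) * p x <= P x.
  by rewrite lerDl addr_ge0 ?(mulr_ge0 ek0) // mulr_ge0 // subr_ge0.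
have Q_ge x : (1 - eps) * q x <= Q x.
  by rewrite lerDl addr_ge0 ?(mulr_ge0 ek0) // mulr_ge0 // subr_ge0.
have e1' : 0 <= 1 - eps by rewrite subr_ge0.
exists P, Q; split.
- apply/huberP => //; split=> //; split=> [x|].
    by apply: le_trans (P_ge x); rewrite mulr_ge0.
  rewrite /P !big_split -!mulr_sumr sumrB -mulr_sumr /= p1 q1 Q'1; nra.
- apply/huberP => //; split=> //; split=> [x|].
    by apply: le_trans (Q_ge x); rewrite mulr_ge0.
  rewrite /Q !big_split -!mulr_sumr sumrB -mulr_sumr /= p1 q1 P'1; nra.
- apply: (hellinger_shift P' Q' P Q k (fun x => k * ((1 + eps) * p x - P' x) +
    k * ((1 + eps) * q x - Q' x) + eps * (1 - k) * p x)) => //.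
  + by rewrite k0.
  + by move=> x; rewrite !addr_ge0 ?(mulr_ge0 ek0) // mulr_ge0 // subr_ge0.
  + by move=> x; rewrite /P -kE; ring.
  + by move=> x; rewrite /Q -kE; ring.
Qed.

(** * The passage from Huber to subtractive pairs *)

Lemma enlarge_to_sum (e D : X -> R) (L : R) :
  (forall x, e x <= D x) -> \sum_x e x <= L <= \sum_x D x ->
  exists2 t : X -> R, forall x, e x <= t x <= D x & \sum_x t x = L.
Proof.
move=> eD /andP[eL LD].
have [DE|DE] := eqVneq (\sum_x D x) (\sum_x e x).
  exists e; first by move=> x; rewrite lexx eD.
  by apply/eqP; rewrite eq_le eL /= -DE.
pose th := (L - \sum_x e x) / (\sum_x D x - \sum_x e x).
have d0 : 0 < \sum_x D x - \sum_x e x.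
  by rewrite subr_gt0 lt_neqAle eq_sym DE (le_trans eL).
have th0 : 0 <= th by apply: divr_ge0; [rewrite subr_ge0 | exact: ltW].
have th1 : th <= 1 by rewrite ler_pdivrMr // mul1r lerD2r.
exists (fun x => e x + th * (D x - e x)).
  by move=> x; have := eD x; nra.
rewrite big_split -mulr_sumr sumrB /= divfK ?lt0r_neq0 //; ring.
Qed.

Definition excess p q x : R := Num.max 0 (q x - p x).

(** Pointwise, [|p - q| + (q - p)] is twice the positive part of [q - p], and the signed terms sum
    to zero. *)
Lemma sum_excess p q : simplex p -> simplex q ->
  \sum_x excess p q x = tv_dist p q.
Proof.
move=> [_ p1] [_ q1].
have -> : tv_dist p q = 2^-1 * (\sum_x `|p x - q x| + (\sum_x q x - \sum_x p x)).
  by rewrite p1 q1 subrr addr0.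
rewrite -sumrB -big_split mulr_sumr; apply: eq_bigr => x _ /=.
rewrite /excess; case: (lerP 0 (q x - p x)) => h.
  by rewrite ler0_norm; [field | lra].
by rewrite gtr0_norm; [field | lra].
Qed.

Lemma tv_distC p q : tv_dist p q = tv_dist q p.
Proof. by rewrite /tv_dist; congr (_ * _); apply: eq_bigr => x _; rewrite distrC. Qed.

(** The minimum of the excess and [L] times the Huber addition has total at most [L * eps], and is
    enlarged to that total below the excess. Where [t] stays under the excess, the minimum is the
    first-named candidate's competitor, the scaled addition. *)
Lemma removal p q P (L eps : R) : simplex p -> simplex q -> huber p eps P ->
  0 <= eps <= 1 -> 0 <= L -> L * eps <= tv_dist p q ->
  exists t : X -> R, [/\ forall x, 0 <= t x <= excess p q x,
    \sum_x t x = L * eps &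
    forall x, t x < excess p q x -> L * (P x - (1 - eps) * p x) <= excess p q x].
Proof.
move=> sp sq /huberP hP e01 L0 Ltv; have [//|//|[P0 P1] pP] := hP.
have ex0 x : 0 <= excess p q x by rewrite le_max lexx.
have a0 x : 0 <= L * (P x - (1 - eps) * p x) by rewrite mulr_ge0 // subr_ge0.
pose e x := Num.min (L * (P x - (1 - eps) * p x)) (excess p q x).
have eD x : e x <= excess p q x by rewrite ge_min lexx orbT.
have e0 x : 0 <= e x by rewrite le_min a0 ex0.
have [||t et tL] := enlarge_to_sum e (excess p q) (L * eps).
- exact: eD.
- rewrite sum_excess // Ltv andbT.
  apply: (@le_trans _ _ (\sum_x L * (P x - (1 - eps) * p x))).
    by apply: ler_sum => x _; rewrite ge_min lexx.
  by rewrite -mulr_sumr sumrB -mulr_sumr P1 (proj2 sp) mulr1 opprB addrC subrK.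
exists t; split=> // [x|x tx].
  by case/andP: (et x) => h ->; rewrite (le_trans (e0 x)).
have [h _] := andP (et x); have := le_lt_trans h tx.
by rewrite /e minElt; case: ifP => [/ltW//|_]; rewrite ltxx.
Qed.

(* When part of the surplus [q - p] survives the removal, the Huber adversary did
   not close the gap at this point: [Q1 - P] is still a fraction of [q - p]. *)
Lemma sqrt_gap (p q P Q Q1 t k : R) :
  0 <= p -> 0 <= P -> 0 < k -> 0 <= t <= q - p -> Q1 <= q -> Q1 <= Q ->
  (t < q - p -> k * (q - p) <= Q1 - P) ->
  (Num.sqrt (q - t) - Num.sqrt p) ^+ 2 <=
    4 / k ^+ 2 * (Num.sqrt Q - Num.sqrt P) ^+ 2.
Proof.
move=> p0 P0 k0 /andP[t0]; rewrite le_eqVlt => /orP[/eqP -> _ _ _|tD].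
  rewrite subKr subrr expr0n /=.
  by rewrite mulr_ge0 ?sqr_ge0 // divr_ge0 // sqr_ge0.
move=> Q1q Q1Q /(_ tD) gap.
have qp : p < q by lra.
have q0 : 0 < q by lra.
have PQ1 : P <= Q1 by rewrite -subr_ge0; apply: le_trans gap; rewrite mulr_ge0; lra.
have Q10 : 0 <= Q1 by lra.
have := ler_wsqrtr (_ : q - t <= q); rewrite lerBlDr lerDl => /(_ t0).
have := ler_wsqrtr (_ : p <= q - t); rewrite lerBrDr -lerBrDl => /(_ (ltW tD)).
have := ler_wsqrtr Q1q; have := ler_wsqrtr Q1Q; have := ler_wsqrtr PQ1.
have := sqr_sqrtr (ltW q0); have := sqr_sqrtr p0.
have := sqr_sqrtr P0; have := sqr_sqrtr Q10.
have := sqrtr_ge0 P; have := sqrtr_ge0 p; have : 0 < Num.sqrt q by rewrite sqrtr_gt0.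
move: (Num.sqrt (q - t)) (Num.sqrt p) (Num.sqrt q) (Num.sqrt Q1) (Num.sqrt Q)
  (Num.sqrt P) => z a b u w v b0 a0 v0 uE vE aE bE vu uw ub az zb.
(* Multiplied by [b], the chain reads [k * (b - a) * b <= k * (q - p) <= Q1 - P = (u - v) * (u + v)
   <= 2 * b * (u - v)]. *)
have lin : k * (z - a) <= 2 * (w - v).
  apply: (@le_trans _ _ (k * (b - a))); first by rewrite ler_wpM2l ?(ltW k0) // lerD2r.
  apply: (@le_trans _ _ (2 * (u - v))); last by lra.
  rewrite -(ler_pM2r b0).
  have h1 : k * (b - a) * b <= k * (b - a) * (b + a).
    by apply: ler_wpM2l; [apply: mulr_ge0; lra | lra].
  have h2 : (u - v) * (u + v) <= (u - v) * (2 * b) by apply: ler_wpM2l; lra.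
  have h3 : k * (b - a) * (b + a) <= (u - v) * (u + v).
    by have := gap; rewrite -uE -vE -aE -bE; lra.
  lra.
rewrite mulrAC ler_pdivlMr ?exprn_gt0 //.
have kza : 0 <= k * (z - a) by apply: mulr_ge0; lra.
have := ler_pM kza kza lin lin; lra.
Qed.

(** As [(1 + tau) * (1 - tau / 2) >= 1], the addition is at most [(1 - tau / 2) * (q - p)]; what
    remains is at least [(tau / 2 - eps) * (q - p)]. *)
Lemma gap_after_removal (p q P L eps tau : R) : L = 1 + tau ->
  0 < tau <= 1 -> eps <= tau / 4 -> p <= q ->
  L * (P - (1 - eps) * p) <= q - p ->
  tau / 4 * (q - p) <= (1 - eps) * q - P.
Proof.
move=> -> /andP[tau0 tau1] et pq h.
have : P - (1 - eps) * p <= (1 - tau / 2) * (q - p).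
  rewrite -(ler_pM2l (_ : 0 < 1 + tau)); last by lra.
  apply: le_trans h _; rewrite mulrA ler_peMl ?subr_ge0 //; nra.
nra.
Qed.

(** The bound on [delta] is what keeps the masses below [(1 + delta) * p] and [(1 + delta) * q]
    after division by [c]. The factor 128 is [4 * 4 ^+ 2] from [sqrt_gap] times 2 from [c^-1]. *)
Lemma huber_to_subtractive p q (eps delta tau : R) P Q :
  simplex p -> simplex q -> 0 < tau <= 1 -> 0 <= eps <= tau / 4 ->
  (1 + tau) * eps <= tv_dist p q ->
  1 <= (1 + delta) * (1 - (1 + tau) * eps) ->
  huber p eps P -> huber q eps Q ->
  exists P' Q', [/\ subtractive p delta P', subtractive q delta Q' &
    hellinger P' Q' <= 128 / tau ^+ 2 * hellinger P Q].
Proof.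
move=> sp sq tau01 /andP[e0 et] Ltv de hP hQ; have /andP[tau0 tau1] := tau01.
have e01 : 0 <= eps <= 1 by rewrite e0; lra.
have [p0 p1] := sp; have [q0 q1] := sq.
pose L := 1 + tau.
have L0 : 0 <= L by rewrite /L; lra.
have [t [tD tL tP]] := removal p q P L eps sp sq hP e01 L0 Ltv.
have Ltv' : L * eps <= tv_dist q p by rewrite tv_distC.
have [s [sD sL sQ]] := removal q p Q L eps sq sp hQ e01 L0 Ltv'.
move: hP hQ => /huberP[//|//|[P0 P1] pP] /huberP[//|//|[Q0 Q1] qQ].
pose c := 1 - L * eps.
have c2 : 2^-1 <= c by rewrite /c /L; nra.
have c0 : 0 < c by lra.
have sp' x : 0 <= s x <= p x.
  case/andP: (sD x) => -> /= h; apply: le_trans h _.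
  by rewrite ge_max p0 /= lerBlDr lerDl.
have tq' x : 0 <= t x <= q x.
  case/andP: (tD x) => -> /= h; apply: le_trans h _.
  by rewrite ge_max q0 /= lerBlDr lerDl.
have normalised (A r : X -> R) : simplex A -> (forall x, 0 <= r x <= A x) ->
    \sum_x r x = L * eps -> subtractive A delta (fun x => (A x - r x) / c).
  move=> [A0 A1] rA rL; split; first split.
  - by move=> x; case/andP: (rA x) => _ h; apply: divr_ge0; [rewrite subr_ge0 | exact: ltW].
  - by rewrite -mulr_suml sumrB A1 rL divff // lt0r_neq0.
  - move=> x; rewrite ler_pdivrMr //; case/andP: (rA x) => r0 _.
    have := ler_wpM2r (A0 x) de; rewrite -/L -/c; nra.
exists (fun x => (p x - s x) / c), (fun x => (q x - t x) / c); split.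
- exact: normalised.
- exact: normalised.
rewrite /hellinger mulr_sumr; apply: ler_sum => x _.
have px := p0 x; have qx := q0 x; have Px := P0 x; have Qx := Q0 x.
rewrite !sqrtrM; first last.
- by case/andP: (sp' x); rewrite subr_ge0.
- by case/andP: (tq' x); rewrite subr_ge0.
rewrite -mulrBl exprMn sqr_sqrtr ?invr_ge0 ?(ltW c0) //.
have ci : c^-1 <= 2 by rewrite -[leRHS]invrK lef_pV2 ?posrE // invr_gt0.
have -> : 128 / tau ^+ 2 = 4 / (tau / 4) ^+ 2 * 2 by field; rewrite lt0r_neq0.
rewrite [leRHS]mulrAC ler_pM ?sqr_ge0 ?invr_ge0 ?(ltW c0) //.
have k0 : 0 < tau / 4 by lra.
have shrink (a : R) : 0 <= a -> (1 - eps) * a <= a by move=> a0; nra.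
(* Only the larger of the two masses is reduced at [x], so [sqrt_gap] applies with the roles fixed
   by the order. *)
have [pq|qp] := lerP (p x) (q x).
  have exq : excess p q x = q x - p x by rewrite /excess max_r // subr_ge0.
  have exp : excess q p x = 0 by rewrite /excess max_l // subr_le0.
  have -> : s x = 0 by apply/eqP; rewrite eq_le -{1}exp andbC; exact: sD.
  have sqC (a b : R) : (a - b) ^+ 2 = (b - a) ^+ 2 by ring.
  rewrite subr0 (sqC (Num.sqrt (p x))) (sqC (Num.sqrt (P x))).
  apply: (sqrt_gap _ _ _ _ ((1 - eps) * q x)) => //; rewrite -?exq //.
  - exact: shrink.
  - move=> /tP; rewrite exq => h; exact: (gap_after_removal _ _ _ L eps).
have exp : excess q p x = p x - q x by rewrite /excess max_r // subr_ge0 ltW.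
have exq : excess p q x = 0 by rewrite /excess max_l // subr_le0 ltW.
have -> : t x = 0 by apply/eqP; rewrite eq_le -{1}exq andbC; exact: tD.
rewrite subr0; apply: (sqrt_gap _ _ _ _ ((1 - eps) * p x)) => //; rewrite -?exp //.
- exact: shrink.
- move=> /sQ; rewrite exp => h; exact: (gap_after_removal _ _ _ L eps _ _ _ _ (ltW qp)).
Qed.
End Contamination.

Theorem theorem6p11 (R : realType) (delta0 : R) (delta0_gt0 : 0 < delta0) :
  exists eps_bar C : R,
    [/\ 0 < eps_bar, 0 < C &
      forall (X : finType) (p q : X -> R) (eps : R),
        simplex p -> simplex q ->
        0 <= eps -> eps <= tv_dist p q / 4 -> eps < eps_bar ->
        (n_sub p q eps <= C%:E * n_hub p q eps)%E /\
        (n_hub p q eps <= C%:E * n_sub p q ((1 + delta0) * eps))%E].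
Proof.
(* Half of [delta0] pays for removing [1 + tau] times [eps]; the rest absorbs the quadratic terms of
   the normalisation. *)
pose tau := Num.min 1 (delta0 / 2).
have tau0 : 0 < tau by rewrite lt_min ltr01 divr_gt0.
have tau1 : tau <= 1 by rewrite ge_min lexx.
have taud : 2 * tau <= delta0.
  have : tau <= delta0 / 2 by rewrite ge_min lexx orbT.
  lra.
(* One [K] serves both directions: the first only asks for [K >= 1], the second for
   [128 / tau ^+ 2]. *)
pose K := (Num.bound (128 / tau ^+ 2)).+1.
have tauK : 128 / tau ^+ 2 <= K%:R.
  apply/ltW/(@lt_trans _ _ (Num.bound (128 / tau ^+ 2))%:R); last by rewrite ltr_nat.
  by rewrite archi_boundP // divr_ge0 // sqr_ge0.
exists (tau / (4 * (1 + delta0))), (76 * K)%:R; split.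
- by rewrite divr_gt0 // mulr_gt0 // addr_gt0.
- by rewrite ltr0n muln_gt0.
move=> X p q eps sp sq e0 etv; rewrite ltr_pdivlMr; last by lra.
move=> ebar.
have dtau : (1 + delta0) * eps <= tau / 4 by lra.
have etau : eps <= tau / 4 by nra.
have e01 : 0 <= eps <= 1 by rewrite e0; lra.
have hell0 P Q : 0 <= @hellinger R X P Q by apply: sumr_ge0 => x _; exact: sqr_ge0.
split; apply: sample_complexity_le => // n; apply: testable_transfer.
- exact: huber_simplex.
- exact: huber_simplex.
- exact: subtractive_simplex.
- exact: subtractive_simplex.
- exact: subtractive_mix.
- exact: subtractive_mix.
- by exists p; exact: subtractive_self.
- by exists q; exact: subtractive_self.
- move=> P' Q' sP' sQ'.
  have [P [Q [hP hQ PQ]]] := subtractive_to_huber p q eps P' Q' sp sq e01 sP' sQ'.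
  exists P, Q; split=> //; apply: le_trans PQ _.
  by rewrite ler_peMl // ler1n.
- exact: subtractive_simplex.
- exact: subtractive_simplex.
- exact: huber_simplex.
- exact: huber_simplex.
- exact: huber_mix.
- exact: huber_mix.
- by exists p; exact: huber_self.
- by exists q; exact: huber_self.
move=> P Q hP hQ.
have [||||P' [Q' [sP' sQ' PQ]]] := huber_to_subtractive p q eps
  ((1 + delta0) * eps) tau P Q sp sq _ _ _ _ hP hQ.
- by rewrite tau0.
- by rewrite e0.
- nra.
(* The product in the goal exceeds 1 by exactly this quantity; its bracket is nonnegative since
   [(1 + tau) * (1 + tau / 4) <= 1 + 2 * tau]. *)
- have : 0 <= eps * (1 + delta0 - (1 + tau) * (1 + (1 + delta0) * eps)).
    by rewrite mulr_ge0 // subr_ge0; nra.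
  lra.
exists P', Q'; split=> //; apply: le_trans PQ _.
by rewrite ler_wpM2r.
Qed.
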